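(* There exists an online game, for NDCG with top-1 feedback (that is, a choice of the number of items $m$, with binary relevance vectors), such that for every learner's algorithm there is an adversary strategy generating relevance vectors such that the expected regret of the learner is $\Omega(T)$; i.e. there are constants $c>0$ and $T_0$ such that for all $T\ge T_0$ and every (possibly randomized) learner's algorithm there exist $R_1,\dots,R_T\in\{0,1\}^m$ for which the expected regret is at least $cT$. Furthermore, the same lower bound holds if NDCG is replaced by AP or by AUC.
   Context: A permutation $\sigma$ of the items $1,\dots,m$ maps ranks to items, $\sigma^{-1}$ maps items to ranks. For $R\in\{0,1\}^m$: $\mathrm{NDCG}(\sigma,R)=\frac1{Z(R)}\sum_{i=1}^m\frac{R(i)}{\log_2(1+\sigma^{-1}(i))}$ with $Z(R)=\max_\sigma\sum_{i=1}^m\frac{R(i)}{\log_2(1+\sigma^{-1}(i))}$ (gain); $\mathrm{AP}(\sigma,R)=\frac1{\|R\|_1}\sum_{i=1}^m\frac{\sum_{j\le i}\mathbb{1}(R(\sigma(j))=1)}{i}\mathbb{1}(R(\sigma(i))=1)$ (gain); $\mathrm{AUC}(\sigma,R)=\frac1{N(R)}\sum_{i=1}^m\sum_{j=1}^m\mathbb{1}(\sigma^{-1}(i)<\sigma^{-1}(j))\mathbb{1}(R(i)<R(j))$ with $N(R)=\|R\|_1(m-\|R\|_1)$ (loss). When the normalizer is $0$, the value is taken to be $1$ for NDCG and AP, and $0$ for AUC. Online game over $T$ rounds with an oblivious adversary, who fixes $R_1,\dots,R_T$: at round $t$ the learner outputs a permutation $\sigma_t$, possibly randomized and based on past feedback,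 and then observes only $R_t(\sigma_t(1))$ (top-1 feedback). The expected regret for a loss $RL$ is $\mathbb{E}[\sum_{t=1}^TRL(\sigma_t,R_t)]-\min_\sigma\sum_{t=1}^TRL(\sigma,R_t)$; for a gain $RL$ it is $\max_\sigma\sum_{t=1}^TRL(\sigma,R_t)-\mathbb{E}[\sum_{t=1}^TRL(\sigma_t,R_t)]$. *)

(* Defs.v *)
From HB Require Import structures.
From mathcomp Require Import all_boot all_order all_algebra all_fingroup.
From mathcomp Require Import all_classical all_reals all_analysis.

Set Implicit Arguments.
Unset Strict Implicit.
Unset Printing Implicit Defensive.

Import Order.TTheory GRing.Theory Num.Theory.

Local Open Scope ring_scope.

(* Items and ranks are both numbered from 0, so rank [i : 'I_m] here is the
   rank [i + 1] of the literature.  A permutation maps ranks to items. *)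

Definition relevance (m : nat) := {ffun 'I_m -> bool}.

Section Measures.
Context {R : realType} {m : nat}.
Implicit Types (s : 'S_m) (r : relevance m).

Definition log2 (x : R) : R := ln x / ln 2.

(* The initial value of the big operators is a value of [F], so these are the
   extrema of [F] over all permutations whatever its sign. *)
Definition max_perm (F : 'S_m -> R) : R :=
  \big[Num.max/F 1%g]_(s : 'S_m) F s.

Definition min_perm (F : 'S_m -> R) : R :=
  \big[Num.min/F 1%g]_(s : 'S_m) F s.

Definition l1norm r : nat := (\sum_(i < m) r i)%N.

(* The one-based rank of item [i] is [((s^-1)%g i).+1]. *)
Definition DCG s r : R :=
  \sum_(i < m) (r i)%:R / log2 (1 + ((s^-1)%g i).+1%:R).

Definition NDCG s r : R :=
  let Z := max_perm (fun s' => DCG s' r) in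
  if Z == 0 then 1 else Z^-1 * DCG s r.

Definition AP s r : R :=
  let Z : R := (l1norm r)%:R in
  if Z == 0 then 1 else
  Z^-1 * \sum_(i < m)
    ((\sum_(j < m | (j <= i)%N) r (s j))%N%:R / i.+1%:R * (r (s i))%:R).

Definition AUC s r : R :=
  let N : R := (l1norm r * (m - l1norm r))%N%:R in
  if N == 0 then 0 else
  N^-1 * \sum_(i < m) \sum_(j < m)
    (((s^-1)%g i < (s^-1)%g j)%N%:R * (r i < r j)%N%:R).

End Measures.

Section Game.
Context {n : nat}.

(* The learner with its internal randomness fixed: the next permutation as a
   function of the feedback bits observed so far, oldest first.  Its own past
   permutations are themselves determined by these bits. *)
Definition strategy := seq bool -> 'S_n.+1.

Definition feedback (a : strategy) (rs : seq (relevance n.+1)) : seq bool :=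
  foldl (fun h (r : relevance n.+1) => rcons h (r (a h ord0))) [::] rs.

Definition played (a : strategy) (rs : seq (relevance n.+1)) (t : nat) :
    'S_n.+1 :=
  a (feedback a (take t rs)).

Context {R : realType}.
Implicit Type RL : 'S_n.+1 -> relevance n.+1 -> R.

Definition fixed_total RL (T : nat) (rs : T.-tuple (relevance n.+1))
    (s : 'S_n.+1) : R :=
  \sum_(t < T) RL s (tnth rs t).

Definition learner_total RL (T : nat) (rs : T.-tuple (relevance n.+1))
    (a : strategy) : R :=
  \sum_(t < T) RL (played a rs t) (tnth rs t).

Context {d : measure_display} {Omega : measurableType d}.

(* A randomized learner draws its internal randomness [w] once, in an arbitrary
   probability space, and then follows the strategy [A w]. *)
Definition measurable_learner (A : Omega -> strategy) : Prop :=
  forall (h : seq bool) (s : 'S_n.+1), measurable [set w | A w h = s]%classic.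

Definition gain_regret (P : probability Omega R) RL (A : Omega -> strategy)
    (T : nat) (rs : T.-tuple (relevance n.+1)) : \bar R :=
  ((max_perm (fixed_total RL rs))%:E
     - 'E_P[fun w => learner_total RL rs (A w)])%E.

Definition loss_regret (P : probability Omega R) RL (A : Omega -> strategy)
    (T : nat) (rs : T.-tuple (relevance n.+1)) : \bar R :=
  ('E_P[fun w => learner_total RL rs (A w)]
     - (min_perm (fixed_total RL rs))%:E)%E.

End Game.

Arguments strategy : clear implicits.

(* Main.v *)
(* Four items.  Let [p] be uniform on the relevance vectors with sets of
   relevant items {0}, {1}, {2, 3}, and [q] uniform on {2}, {3}, {0, 1}.  Under
   both, every single item is relevant with probability 1/3, so against i.i.d.
   vectors top-1 feedback has the same law under [p] and [q] whatever the
   learner does.  But normalization rewards a single relevant item more than a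
   member of a pair: for [p] it is best to rank 0 and 1 first, for [q] to rank 2
   and 3 first, and no permutation is close to optimal for both.  Hence the
   expected regrets under [p] and [q] add up to a positive constant per round,
   and some fixed sequence of vectors is at least as bad as the average. *)
Require Import Defs.
From mathcomp Require Import all_boot all_order all_algebra all_fingroup.
From mathcomp Require Import all_classical all_reals all_analysis.
From mathcomp Require Import ring lra.
Import measurable_realfun.

Import Order.TTheory GRing.Theory Num.Theory.

Local Open Scope ring_scope.

(** * Play from a given history, and its sums over i.i.d. words *)

Section Run.
Context {R : realType} {n : nat}.
Implicit Types (F : 'S_n.+1 -> relevance n.+1 -> R) (a : strategy n).
Implicit Types (h : seq bool) (rs ps qs : seq (relevance n.+1)).

(** The starting history [h] is an argument so that inductions on the rounds can generalize over it;
    the learner's total is the case of the empty history. *)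
Fixpoint run F a h rs : R :=
  if rs is r :: rs' then F (a h) r + run F a (rcons h (r (a h ord0))) rs'
  else 0.

Lemma run_nth F a h rs r0 :
  run F a h rs = \sum_(t < size rs)
    F (a (foldl (fun h (r : relevance n.+1) => rcons h (r (a h ord0))) h
            (take t rs))) (nth r0 rs t).
Proof.
elim: rs h => [|r rs IH] h /=; first by rewrite big_ord0.
by rewrite big_ord_recl IH.
Qed.

Lemma learner_total_run F T (rs : T.-tuple (relevance n.+1)) a :
  learner_total F rs a = run F a [::] rs.
Proof.
case: T rs => [|T] rs; first by rewrite tuple0 /learner_total big_ord0.
rewrite (run_nth F a [::] rs (thead rs)) /learner_total size_tuple.
by apply: eq_bigr => t _; rewrite (tnth_nth (thead rs)).
Qed.

Lemma runB F1 F2 a h rs :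
  run (fun s r => F1 s r - F2 s r) a h rs = run F1 a h rs - run F2 a h rs.
Proof. by elim: rs h => [|r rs IH] h /=; rewrite ?IH; ring. Qed.

Lemma run_fixed F s a h rs :
  run (fun=> F s) a h rs = \sum_(r <- rs) F s r.
Proof. by elim: rs h => [|r rs IH] h /=; rewrite ?big_nil ?big_cons ?IH. Qed.

Lemma run_bound F a h rs : `|run F a h rs| <= \sum_(r <- rs) \sum_s `|F s r|.
Proof.
elim: rs h => [|r rs IH] h /=; first by rewrite normr0 big_nil.
rewrite big_cons (le_trans (ler_normD _ _))// lerD//.
by rewrite (bigD1 (a h))//= lerDl sumr_ge0.
Qed.

(** Repetitions are kept, so averaging over [words T ps] is taking the expectation over [T]
    independent uniform draws from [ps]. *)
Fixpoint words (T : nat) ps : seq (seq (relevance n.+1)) :=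
  if T is T'.+1 then [seq r :: w | r <- ps, w <- words T' ps] else [:: [::]].

Lemma size_words T ps : size (words T ps) = (size ps ^ T)%N.
Proof. by elim: T => [|T IH] //=; rewrite size_allpairs IH expnS. Qed.

Lemma size_mem_words T ps w : w \in words T ps -> size w = T.
Proof.
elim: T w => [|T IH] w /=; first by rewrite inE => /eqP ->.
by case/allpairsP => -[r v] /= [_ /IH <- ->].
Qed.

(** The first vector influences later rounds only through its bit at the top item, so the remaining
    sum can be indexed by these bits alone. *)
Lemma sum_run_wordsS F a h T ps :
  \sum_(w <- words T.+1 ps) run F a h w =
  (\sum_(r <- ps) F (a h) r) *+ (size ps ^ T) +
  \sum_(b <- [seq r (a h ord0) | r : relevance n.+1 <- ps])
     \sum_(w <- words T ps) run F a (rcons h b) w.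
Proof.
rewrite big_allpairs_dep big_map -sumrMnl -big_split /=.
apply: eq_bigr => r _; rewrite big_split /=; congr (_ + _).
by rewrite big_const_seq count_predT iter_addr_0 size_words.
Qed.

(* The feedback of [ps]-words and of [qs]-words has the same law, so at every
   feedback history the learner plays one permutation against both. *)
Lemma sum_run_words_ge F1 F2 ps qs (c : R) :
  (forall i, perm_eq [seq r i | r : relevance n.+1 <- ps]
                     [seq r i | r : relevance n.+1 <- qs]) ->
  (forall s, c *+ (size ps + size qs) <=
     \sum_(r <- ps) F1 s r + \sum_(r <- qs) F2 s r) ->
  forall T a h, c * T%:R *+ (size (words T ps) + size (words T qs)) <=
    \sum_(w <- words T ps) run F1 a h w + \sum_(w <- words T qs) run F2 a h w.
Proof.
move=> eqpq hc T a.
have szpq : size qs = size ps.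
  by have /perm_size := eqpq ord0; rewrite !size_map => ->.
elim: T => [|T IH] h.
  by rewrite /= !big_seq1 /= mulr0 mul0rn addr0.
(* Equal marginals at the item [a h ord0] let the bits of [qs] be replaced by those of [ps]; both
   continuations then share the same histories. *)
rewrite !sum_run_wordsS !size_words addrACA -(perm_big _ (eqpq _)) /= !big_map.
rewrite szpq -mulrnDl -big_split /=.
move: hc IH; rewrite !size_words szpq !addnn => hc IH.
(* The bound splits into the share of the first round and one induction hypothesis for each first
   vector. *)
have -> : c * T.+1%:R *+ (size ps ^ T.+1).*2 =
    c *+ (size ps).*2 *+ size ps ^ T + c * T%:R *+ (size ps ^ T).*2 *+ size ps.
  rewrite -!mulrnA -!muln2 -[c *+ _]mulr_natr -!(mulr_natr (c * _)).
  by rewrite expnS !natrM -natr1; ring.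
apply: lerD; first exact: ler_wMn2r.
rewrite -[in leLHS](count_predT ps) -iter_addr_0 -big_const_seq /=.
by apply: ler_sum => r _; exact: IH.
Qed.

End Run.

(** * Integrating over the learner's randomness *)

Section Measurability.
Context {R : realType} {n : nat}.
Context {d : measure_display} {Omega : measurableType d}.
Context (P : probability Omega R).

Lemma measurable_run (F : 'S_n.+1 -> relevance n.+1 -> R)
    (A : Omega -> strategy n) h rs :
  measurable_learner A -> measurable_fun setT (fun w => run F (A w) h rs).
Proof.
move=> mA; elim: rs h => [|r rs IH] h /=; first exact: measurable_cst.
(* Splitting by the value of [A w h] fixes the permutation played, hence also the next history. *)
rewrite [X in measurable_fun _ X](_ : _ = fun w => \sum_(s : 'S_n.+1)
   \1_[set w | A w h = s]%classic w *
     (F s r + run F (A w) (rcons h (r (s ord0))) rs)); last first.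
  apply/funext => w; rewrite (bigD1 (A w h))//= big1 ?addr0.
    by rewrite indicE mem_set// mul1r.
  by move=> s /eqP sA; rewrite indicE memNset ?mul0r//= => /esym.
apply: measurable_sum => s; apply: measurable_funM.
  exact/measurable_indic/mA.
by apply: measurable_funD => //; exact: IH.
Qed.

Lemma integrable_run (F : 'S_n.+1 -> relevance n.+1 -> R)
    (A : Omega -> strategy n) h rs :
  measurable_learner A ->
  P.-integrable setT (EFin \o (fun w => run F (A w) h rs)).
Proof.
move=> mA; apply: measurable_bounded_integrable => //.
- exact: le_lt_trans (probability_le1 P measurableT) (ltry 1).
- exact: measurable_run.
- exists (\sum_(r <- rs) \sum_s `|F s r|); split; first exact: num_real.
  move=> x /ltW xb w _ /=; exact: le_trans (run_bound _ _ _ _) xb.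
Qed.

(** Derandomizes the adversary: a lower bound on the average over [W] at every [w] survives
    integration, so a single member of [W], independent of [w], attains it. *)
Lemma exists_expectation_ge (I : eqType) (W : seq I) (X : I -> Omega -> R)
    (b : R) :
  W != [::] -> (forall i, P.-integrable setT (EFin \o X i)) ->
  (forall w, b *+ size W <= \sum_(i <- W) X i w) ->
  exists2 i, i \in W & (b%:E <= 'E_P[X i])%E.
Proof.
move=> W0 iX hb; apply: contrapT => nex.
have fE i : 'E_P[X i]%E \is a fin_num.
  by rewrite unlock; exact: integrable_fin_num (iX i).
have lt_b i : i \in W -> fine 'E_P[X i] < b.
  move=> iW; rewrite ltNge; apply/negP => bi; apply: nex; exists i => //.
  by rewrite -(fineK (fE i)) lee_fin.
have : ((b *+ size W)%:E <= \sum_(i <- W) 'E_P[X i])%E.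
  rewrite [leRHS](_ : _ = \int[P]_w (\sum_(i <- W) (X i w)%:E))%E; last first.
    by rewrite integral_sum//; apply: eq_bigr => i _; rewrite unlock.
  rewrite -[leLHS]mule1 -(@probability_setT _ _ _ P) -integral_cst//.
  apply: le_integral => //.
  - exact: finite_measure_integrable_cst.
  - by apply: integrable_sum => // i _; exact: iX.
  - by move=> w _; rewrite sumEFin lee_fin.
under eq_bigr do rewrite -(fineK (fE _)).
rewrite sumEFin lee_fin leNgt => /negP; apply.
rewrite -(count_predT W) -iter_addr_0 -big_const_seq.
(* Nonemptiness makes the inequality strict: the head is compared strictly, the tail weakly. *)
case: W W0 {hb nex} lt_b => [//|i W] _ lt_b.
rewrite !big_cons ltr_leD ?lt_b ?mem_head// !big_seq.
by apply: ler_sum => j jW; rewrite ltW// lt_b// inE jW orbT.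
Qed.

End Measurability.

(** * From a one-round gap to linear regret *)

Section Game_lower_bound.
Context {R : realType} {n : nat}.
Implicit Types (RL : 'S_n.+1 -> relevance n.+1 -> R).
Implicit Types (ps qs : seq (relevance n.+1)) (s p q : 'S_n.+1).

(** The gap says that [p] on [ps] and [q] on [qs] together beat any single permutation by [c] per
    vector; equal marginals force the learner to use a single one at each history. *)
Lemma exists_regret_ge RL ps qs p q (c : R) T (d : measure_display)
    (Omega : measurableType d) (P : probability Omega R)
    (A : Omega -> strategy n) :
  ps != [::] ->
  (forall i, perm_eq [seq r i | r : relevance n.+1 <- ps]
                     [seq r i | r : relevance n.+1 <- qs]) ->
  (forall s, c *+ (size ps + size qs) +
       (\sum_(r <- ps) RL s r + \sum_(r <- qs) RL s r) <=
     \sum_(r <- ps) RL p r + \sum_(r <- qs) RL q r) ->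
  measurable_learner A ->
  exists (rs : T.-tuple (relevance n.+1)) s,
    ((c * T%:R)%:E <= (fixed_total RL rs s)%:E
       - 'E_P[fun w => learner_total RL rs (A w)])%E.
Proof.
move=> ps0 eqpq gap mA.
(* Each word carries its comparator, [p] or [q]; [X] is the regret against it. *)
pose X (i : 'S_n.+1 * seq (relevance n.+1)) w :=
  run (fun s r => RL i.1 r - RL s r) (A w) [::] i.2.
pose W := [seq (p, w) | w <- words T ps] ++ [seq (q, w) | w <- words T qs].
have W0 : W != [::].
  rewrite -size_eq0 size_cat !size_map !size_words addn_eq0 expn_eq0.
  by rewrite size_eq0 (negPf ps0).
have [i|w|[s rs] Wrs] := @exists_expectation_ge _ _ _ P _ W X (c * T%:R) W0.
- exact: integrable_run.
- rewrite size_cat !size_map big_cat !big_map.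
  apply: (@sum_run_words_ge _ _ (fun s r => RL p r - RL s r)
    (fun s r => RL q r - RL s r)) eqpq _ _ _ _ => s.
  by rewrite !sumrB addrACA -opprD lerBrDr.
have szrs : size rs == T.
  move: Wrs; rewrite mem_cat => /orP[] /mapP[v vw [_ ->]];
  by rewrite (size_mem_words _ _ _ vw).
move=> cE; exists (Tuple szrs), s; rewrite (le_trans cE)//.
have Eq : X (s, rs) = cst (fixed_total RL (Tuple szrs) s) \-
    (fun w => learner_total RL (Tuple szrs) (A w)).
  apply/funext => w /=; rewrite learner_total_run /X runB; congr (_ - _).
  by rewrite run_fixed (big_tuple _ _ (Tuple szrs)).
rewrite Eq expectationB ?Lfun_cst ?expectation_cst//.
apply/Lfun1_integrable.
under [X in EFin \o X]eq_fun do rewrite learner_total_run.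
exact: integrable_run.
Qed.

Lemma max_perm_ge (F : 'S_n.+1 -> R) s : F s <= max_perm F.
Proof. exact: le_bigmax. Qed.

Lemma gain_regret_ge RL ps qs p q (c : R) T (d : measure_display)
    (Omega : measurableType d) (P : probability Omega R)
    (A : Omega -> strategy n) :
  ps != [::] ->
  (forall i, perm_eq [seq r i | r : relevance n.+1 <- ps]
                     [seq r i | r : relevance n.+1 <- qs]) ->
  (forall s, c *+ (size ps + size qs) +
       (\sum_(r <- ps) RL s r + \sum_(r <- qs) RL s r) <=
     \sum_(r <- ps) RL p r + \sum_(r <- qs) RL q r) ->
  measurable_learner A ->
  exists rs : T.-tuple (relevance n.+1),
    ((c * T%:R)%:E <= gain_regret P RL A rs)%E.
Proof.
move=> ps0 eqpq gap mA.
have [rs [s cE]] := exists_regret_ge _ _ _ _ _ _ T _ _ P _ ps0 eqpq gap mA.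
exists rs; rewrite (le_trans cE)// leeD2r// lee_fin.
exact: max_perm_ge.
Qed.

Lemma loss_regret_ge RL ps qs p q (c : R) T (d : measure_display)
    (Omega : measurableType d) (P : probability Omega R)
    (A : Omega -> strategy n) :
  ps != [::] ->
  (forall i, perm_eq [seq r i | r : relevance n.+1 <- ps]
                     [seq r i | r : relevance n.+1 <- qs]) ->
  (forall s, c *+ (size ps + size qs) +
       (\sum_(r <- ps) RL p r + \sum_(r <- qs) RL q r) <=
     \sum_(r <- ps) RL s r + \sum_(r <- qs) RL s r) ->
  measurable_learner A ->
  exists rs : T.-tuple (relevance n.+1),
    ((c * T%:R)%:E <= loss_regret P RL A rs)%E.
Proof.
move=> ps0 eqpq gap mA.
(* A loss is treated as the gain [- RL]. *)
have gapN s : c *+ (size ps + size qs) +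
       (\sum_(r <- ps) - RL s r + \sum_(r <- qs) - RL s r) <=
     \sum_(r <- ps) - RL p r + \sum_(r <- qs) - RL q r.
  by move: (gap s); rewrite !sumrN -!opprD; lra.
have [rs [s cE]] := exists_regret_ge _ _ _ _ _ _ T _ _ P _ ps0 eqpq gapN mA.
exists rs; rewrite (le_trans cE)//.
have -> : (fun w => learner_total (fun s r => - RL s r) rs (A w)) =
          (-1) \o* (fun w => learner_total RL rs (A w)).
  by apply/funext => w /=; rewrite /learner_total sumrN mulrN1.
rewrite expectationZl; last first.
  apply/Lfun1_integrable.
  under [X in EFin \o X]eq_fun do rewrite learner_total_run.
  exact: integrable_run.
rewrite EFinN mulN1e oppeK addeC leeD2l//.
rewrite /fixed_total sumrN lee_fin lerN2.
exact: (bigmin_le _ s).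
Qed.

End Game_lower_bound.

(** * The instance with four items *)

Section Four_items.
Context {R : realType}.
Implicit Types s : 'S_4.

Local Notation i0 := (@Ordinal 4 0 isT).
Local Notation i1 := (@Ordinal 4 1 isT).
Local Notation i2 := (@Ordinal 4 2 isT).
Local Notation i3 := (@Ordinal 4 3 isT).

Lemma ord4 (i : 'I_4) : [\/ i = i0, i = i1, i = i2 | i = i3].
Proof.
by case: i => -[|[|[|[|//]]]] hi; [constructor 1|constructor 2|constructor 3|
  constructor 4]; apply/val_inj.
Qed.

Definition items (l : seq nat) : relevance 4 :=
  [ffun i : 'I_4 => (i : nat) \in l].

(** Named after the items best ranked first: 0 and 1 here, 2 and 3 in [high_first]. *)
Definition low_first : seq (relevance 4) :=
  [:: items [:: 0]; items [:: 1]; items [:: 2; 3]]%N.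

Definition high_first : seq (relevance 4) :=
  [:: items [:: 2]; items [:: 3]; items [:: 0; 1]]%N.

Definition half_swap : 'S_4 := (tperm i0 i2 * tperm i1 i3)%g.

Lemma half_swapE : (half_swap i0 = i2) * (half_swap i1 = i3) *
  (half_swap i2 = i0) * (half_swap i3 = i1).
Proof. by do !split; rewrite permM !permE /=. Qed.

Lemma half_swapV : (half_swap^-1 = half_swap)%g.
Proof.
apply/esym/eqP; rewrite eq_mulgV1 invgK; apply/eqP/permP => i.
by rewrite permM perm1; case: (ord4 i) => ->; rewrite !half_swapE.
Qed.

(** Each item lies in exactly one of the three sets of either list. *)
Lemma items_marginals i :
  perm_eq [seq r i | r : relevance 4 <- low_first]
          [seq r i | r : relevance 4 <- high_first].
Proof. by case: i => -[|[|[|[|//]]]] hi; rewrite /= !ffunE. Qed.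

Lemma sum4 (V : nmodType) (F : 'I_4 -> V) :
  \sum_(i < 4) F i = F i0 + F i1 + F i2 + F i3.
Proof.
rewrite !big_ord_recr big_ord0 /= add0r.
by congr (F _ + F _ + F _ + F _); apply/val_inj.
Qed.

(** * Discounts and the gap for NDCG *)

Definition discount (i : 'I_4) : R := (log2 (1 + i.+1%:R))^-1.

Lemma discount_gt0 i : 0 < discount i.
Proof.
by rewrite /discount /log2 invr_gt0 divr_gt0 ?ln_gt0 ?ltrDl ?(ltr_nat R 1 2).
Qed.

Lemma ltr_discount (i j : 'I_4) : (i < j)%N -> discount j < discount i.
Proof.
move=> ij; have := discount_gt0 i; have := discount_gt0 j.
rewrite /discount !invr_gt0 => j0 i0'; rewrite ltf_pV2// /log2.
rewrite ltr_pM2r ?invr_gt0 ?ln_gt0 ?(ltr_nat R 1 2)//.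
by rewrite ltr_ln ?posrE ?ltrD2l ?ltr_nat// addr_gt0.
Qed.

Lemma DCG_items s l :
  DCG s (items l) = \sum_(i < 4) (val i \in l)%:R * discount (s^-1%g i).
Proof. by apply: eq_bigr => i _; rewrite ffunE. Qed.

Lemma DCG1 s (k : 'I_4) : DCG s (items [:: val k]) = discount (s^-1%g k).
Proof.
rewrite DCG_items (bigD1 k)//= big1 ?addr0 ?mem_head ?mul1r// => i ik.
by rewrite inE val_eqE (negPf ik) mul0r.
Qed.

Lemma DCG2 s (j k : 'I_4) : k != j ->
  DCG s (items [:: val j; val k]) = discount (s^-1%g j) + discount (s^-1%g k).
Proof.
move=> jk; rewrite DCG_items (bigD1 j)//= (bigD1 k)//= big1 ?addr0.
  by rewrite !inE !eqxx orbT !mul1r.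
by move=> i /andP[ij ik]; rewrite !inE !val_eqE (negPf ik) (negPf ij) mul0r.
Qed.

Lemma max_permE (F : 'S_4 -> R) s M :
  F s = M -> (forall s', F s' <= M) -> max_perm F = M.
Proof.
move=> <- FM; apply/le_anti; rewrite max_perm_ge andbT.
by apply: bigmax_le.
Qed.

Lemma max_DCG1 (k : 'I_4) :
  max_perm (fun s => DCG s (items [:: val k])) = discount i0.
Proof.
apply: (@max_permE _ (tperm i0 k)) => [|s]; rewrite DCG1 ?tpermV ?tpermR//.
have [->//|] := eqVneq (s^-1%g k) i0.
by rewrite -(inj_eq val_inj) -lt0n => /(@ltr_discount i0) /ltW.
Qed.

(** The permutation [s] witnesses the maximum; no two distinct ranks have a larger discount sum than
    the first two. *)
Lemma max_DCG2 (j k : 'I_4) s : (s^-1%g j = i0) -> (s^-1%g k = i1) ->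
  max_perm (fun s => DCG s (items [:: val j; val k])) =
  discount i0 + discount i1.
Proof.
move=> sj sk.
have jk : k != j by rewrite -(inj_eq (@perm_inj _ s^-1%g)) sj sk.
apply: (@max_permE _ s) => [|s']; rewrite DCG2 ?sj ?sk//.
have : s'^-1%g j != s'^-1%g k by rewrite (inj_eq perm_inj) eq_sym.
have x01 := @ltr_discount i0 i1 isT; have x12 := @ltr_discount i1 i2 isT.
have x23 := @ltr_discount i2 i3 isT.
by case: (ord4 (s'^-1%g j)) => ->; case: (ord4 (s'^-1%g k)) => -> //= _; lra.
Qed.

Lemma NDCG1 s (k : 'I_4) :
  NDCG s (items [:: val k]) = discount (s^-1%g k) / discount i0.
Proof. by rewrite /NDCG max_DCG1 gt_eqF ?discount_gt0// mulrC DCG1. Qed.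

Lemma NDCG2 s s' (j k : 'I_4) : s'^-1%g j = i0 -> s'^-1%g k = i1 ->
  NDCG s (items [:: val j; val k]) =
  (discount (s^-1%g j) + discount (s^-1%g k)) / (discount i0 + discount i1).
Proof.
move=> sj sk; have x0 := discount_gt0 i0; have x1 := discount_gt0 i1.
have jk : k != j by rewrite -(inj_eq (@perm_inj _ s'^-1%g)) sj sk.
by rewrite /NDCG (max_DCG2 _ _ _ sj sk) gt_eqF ?addr_gt0// mulrC DCG2.
Qed.

(* The left-hand gain does not depend on [s]: between them, [low_first] and
   [high_first] contain every item once alone and once in a pair. *)
Lemma NDCG_gap : exists2 c : R, 0 < c &
  forall s,
    c *+ 6 +
    (\sum_(r <- low_first) NDCG s r + \sum_(r <- high_first) NDCG s r) <=
  \sum_(r <- low_first) NDCG 1%g r + \sum_(r <- high_first) NDCG half_swap r.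
Proof.
pose x := discount; pose y := x i0 + x i1.
have y0 : 0 < y by rewrite addr_gt0// discount_gt0.
have x0 : 0 < x i0 by exact: discount_gt0.
have x1 : 0 < x i1 by exact: discount_gt0.
have x12 : x i2 < x i1 by exact: ltr_discount.
have x23 : x i3 < x i2 by exact: ltr_discount.
have x01 : x i1 < x i0 by exact: ltr_discount.
(* The exact total gap over the six vectors: the discount lost between the top and bottom two ranks,
   times the advantage in weight of an item alone over one in a pair. *)
pose c := (y - (x i2 + x i3)) * ((x i0)^-1 - y^-1).
exists (c / 6%:R).
  by rewrite divr_gt0// mulr_gt0 ?subr_gt0 ?ltf_pV2// /y; lra.
move=> s.
have P1 t (k : 'I_4) := NDCG1 t k.
have P23 t : NDCG t (items [:: 2; 3]%N) = (x (t^-1%g i2) + x (t^-1%g i3)) / y.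
  by apply: (@NDCG2 t half_swap i2 i3); rewrite half_swapV half_swapE.
have P01 t : NDCG t (items [:: 0; 1]%N) = (x (t^-1%g i0) + x (t^-1%g i1)) / y.
  by apply: (@NDCG2 t 1%g i0 i1); rewrite invg1 perm1.
rewrite !big_cons !big_nil !P23 !P01 (P1 _ i0) (P1 _ i1) (P1 _ i2) (P1 _ i3).
rewrite (P1 _ i0) (P1 _ i1) (P1 _ i2) (P1 _ i3).
rewrite !half_swapV !half_swapE !invg1 !perm1 -/x.
have : x (s^-1%g i0) + x (s^-1%g i1) + x (s^-1%g i2) + x (s^-1%g i3) =
       x i0 + x i1 + x i2 + x i3.
  rewrite -(sum4 _ x) -(sum4 _ (fun i => x (s^-1%g i))).
  by rewrite [RHS](reindex_perm s^-1%g).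
have -> : c / 6%:R *+ 6 = c by rewrite -mulr_natr divfK.
rewrite /c /y; set u := (_)^-1; set v := (_ + _)^-1 => E.
(* Eliminating one discount by the constant total turns the claim into an identity. *)
have -> : x (s^-1%g i3) = x i0 + x i1 + x i2 + x i3 -
  (x (s^-1%g i0) + x (s^-1%g i1) + x (s^-1%g i2)) by rewrite -E; ring.
by rewrite le_eqVlt; apply/orP; left; apply/eqP; ring.
Qed.

(** * The gaps for AUC and AP *)

Lemma l1norm_items :
  (l1norm (items [:: 0]) = 1%N) * (l1norm (items [:: 1]) = 1%N) *
  (l1norm (items [:: 2]) = 1%N) * (l1norm (items [:: 3]) = 1%N) *
  (l1norm (items [:: 0; 1]) = 2%N) * (l1norm (items [:: 2; 3]) = 2%N).
Proof. by do !split; rewrite /l1norm sum4 !ffunE. Qed.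

(** For every [s] the loss is 3: the single items count each of six pairs once with weight 1/3, the
    two-item sets each of four cross pairs once with weight 1/4. The adapted permutations lose 4/3
    each, so the gap is exactly 1/3. *)
Lemma AUC_gap s : (3%:R * 6%:R)^-1 *+ 6 +
    (\sum_(r <- low_first) AUC 1%g r +
     \sum_(r <- high_first) AUC half_swap r) <=
  \sum_(r <- low_first) AUC s r + \sum_(r <- high_first) AUC s r :> R.
Proof.
have split (i j : 'I_4) : i != j ->
    (s^-1%g i < s^-1%g j)%N%:R + (s^-1%g j < s^-1%g i)%N%:R = 1 :> R.
  move=> ij; have := ltngtP (s^-1%g i) (s^-1%g j) => -[||/val_inj/perm_inj E].
  - by rewrite addr0.
  - by rewrite add0r.
  - by rewrite E eqxx in ij.
rewrite !big_cons !big_nil /AUC !l1norm_items !pnatr_eq0 !sum4 !ffunE /=.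
rewrite half_swapV !half_swapE !invg1 !perm1 /=.
rewrite -[(1 * (4 - 1))%N]/3%N -[(2 * (4 - 2))%N]/4%N.
have := (split i0 i1 isT, split i0 i2 isT, split i0 i3 isT,
         split i1 i2 isT, split i1 i3 isT, split i2 i3 isT).
by case=> -[] -[] -[] -[]; lra.
Qed.

Lemma AP_items s l : AP s (items l) =
  let Z : R := (l1norm (items l))%:R in
  let b i : R := (val (s i) \in l)%:R in
  if Z == 0 then 1 else
  Z^-1 * (b i0 * b i0 + (b i0 + b i1) / 2 * b i1 +
          (b i0 + b i1 + b i2) / 3 * b i2 +
          (b i0 + b i1 + b i2 + b i3) / 4 * b i3).
Proof.
rewrite /AP sum4 /= !(big_mkcond (fun j : 'I_4 => (j <= _)%N)) !sum4 !ffunE /=.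
by rewrite !addr0 divr1 !natrD.
Qed.

(** The gain of [s] is 42/12 if items 0 and 1 hold the top two or the bottom two ranks, and 41/12
    otherwise; the adapted permutations gain 23/12 each. The least gap is again 1/3. *)
Lemma AP_gap s : (3%:R * 6%:R)^-1 *+ 6 +
    (\sum_(r <- low_first) AP s r + \sum_(r <- high_first) AP s r) <=
  \sum_(r <- low_first) AP 1%g r + \sum_(r <- high_first) AP half_swap r :> R.
Proof.
have sneq (i j : 'I_4) : i != j -> s i != s j by rewrite (inj_eq perm_inj).
rewrite !big_cons !big_nil !AP_items !l1norm_items /= ?oner_eq0 !pnatr_eq0 /=.
rewrite !perm1 !half_swapE /=.
have := sneq i2 i3 isT; have := sneq i1 i3 isT; have := sneq i0 i3 isT.
have := sneq i1 i2 isT; have := sneq i0 i2 isT; have := sneq i0 i1 isT.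
(* Injectivity discards repeated items, leaving the 24 orders. *)
case: (ord4 (s i0)) => ->; case: (ord4 (s i1)) => -> //= _;
  case: (ord4 (s i2)) => -> //= _ _; case: (ord4 (s i3)) => -> //= _ _ _.
all: lra.
Qed.

End Four_items.

Theorem theorem13 (R : realType) :
  (exists (n : nat) (c : R) (T0 : nat), 0 < c /\
     forall T : nat, (T0 <= T)%N ->
     forall (d : measure_display) (Omega : measurableType d)
       (P : probability Omega R) (A : Omega -> strategy n),
       measurable_learner A ->
       exists rs : T.-tuple (relevance n.+1),
         ((c * T%:R)%:E <= gain_regret P NDCG A rs)%E) /\
  (exists (n : nat) (c : R) (T0 : nat), 0 < c /\
     forall T : nat, (T0 <= T)%N ->
     forall (d : measure_display) (Omega : measurableType d)
       (P : probability Omega R) (A : Omega -> strategy n),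
       measurable_learner A ->
       exists rs : T.-tuple (relevance n.+1),
         ((c * T%:R)%:E <= gain_regret P AP A rs)%E) /\
  (exists (n : nat) (c : R) (T0 : nat), 0 < c /\
     forall T : nat, (T0 <= T)%N ->
     forall (d : measure_display) (Omega : measurableType d)
       (P : probability Omega R) (A : Omega -> strategy n),
       measurable_learner A ->
       exists rs : T.-tuple (relevance n.+1),
         ((c * T%:R)%:E <= loss_regret P AUC A rs)%E).
Proof.
have ps0 : low_first != [::] by [].
split; [|split].
(* Four items are [n = 3]; the bound holds for every [T], so [T0] is 0. *)
- have [c c0 gap] := @NDCG_gap R; exists 3, c, 0; split=> // T _ d Omega P A mA.
  exact: gain_regret_ge ps0 items_marginals gap mA.
- exists 3, (3 * 6)^-1, 0; split=> [|T _ d Omega P A mA].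
    by rewrite invr_gt0 mulr_gt0.
  exact: gain_regret_ge ps0 items_marginals AP_gap mA.
- exists 3, (3 * 6)^-1, 0; split=> [|T _ d Omega P A mA].
    by rewrite invr_gt0 mulr_gt0.
  exact: loss_regret_ge ps0 items_marginals AUC_gap mA.
Qed.
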